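(* Let $\mathbb{P}$ be a forcing notion and let $\mathcal{A}=\{A_\xi : \xi<\lambda\}$ be a base matrix for $\mathbb{P}$ of regular height $\lambda > \mathfrak{h}(\mathbb{P})$. Then there is a maximal branch of $\mathcal{A}$ which is not cofinal.
   Context: A forcing notion $\mathbb{P}$ is a partial order $(\mathbb{P},\leq)$. $\mathbb{P}$ is $\delta$-distributive if every family of $\delta$ many maximal antichains of $\mathbb{P}$ has a common refinement (a maximal antichain $B$ refining each of them, where $B$ refines $A$ if for each $b\in B$ there is $a\in A$ with $b\leq a$). The distributivity $\mathfrak{h}(\mathbb{P})$ is the least cardinal $\lambda$ such that $\mathbb{P}$ is not $\lambda$-distributive. A distributivity matrix for $\mathbb{P}$ of height $\lambda$ is a family $\{A_\xi:\xi<\lambda\}$ such that (1) each $A_\xi$ is a maximal antichain in $\mathbb{P}$, (2) $A_\eta$ refines $A_\xi$ whenever $\eta\geq\xi$, and (3) there is no maximal antichain refining every $A_\xi$. It is a base matrix if moreover $\bigcup_{\xi<\lambda}A_\xi$ is dense in $\mathbb{P}$, i.e., for each $p\in\mathbb{P}$ there are $\xi<\lambda$ and $a\in A_\xi$ with $a\leq p$. A branch of $\{A_\xi:\xi<\lambda\}$ is a sequence $\langle a_\xi:\xi<\delta\rangle$ (for some $\delta\leq\lambda$) with $a_\xi\in A_\xi$ for each $\xi<\delta$ and $a_\eta\leq a_\xi$ for $\xi\leq\eta<\delta$; it is maximal if no branch strictly extends it, and cofinal if $\delta=\lambda$. *)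

(* Defs.v *)
From mathcomp Require Import all_boot all_order.
From mathcomp Require Import boolp classical_sets functions cardinality.
From mathcomp Require wochoice.

Set Implicit Arguments.
Unset Strict Implicit.
Unset Printing Implicit Defensive.

Import Order.TTheory.
Local Open Scope classical_set_scope.
Local Open Scope card_scope.
Local Open Scope order_scope.

(* A cardinal is represented by any type of that size, and cardinals are
   compared through [card_le]; an ordinal is represented by a type carrying a
   well-order. *)

Definition card_lt (T U : Type) (A : set T) (B : set U) : Prop :=
  (A #<= B) /\ ~ (B #<= A).

Definition is_ordinal (d : Order.disp_t) (L : orderType d) : Prop :=
  wochoice.well_order (fun x y : L => x <= y).

(* An initial ordinal: no proper initial segment has the size of the whole. *)
Definition is_cardinal (d : Order.disp_t) (L : orderType d) : Prop :=
  is_ordinal L /\ forall x : L, card_lt [set y : L | y < x] [set: L].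

Definition unbounded (d : Order.disp_t) (L : orderType d) (C : set L) : Prop :=
  forall x : L, exists2 y : L, C y & x <= y.

Definition is_regular_cardinal (d : Order.disp_t) (L : orderType d) : Prop :=
  [/\ is_cardinal L, infinite_set [set: L] &
      forall C : set L, unbounded C -> C #= [set: L]].

Section Forcing.
Context {dP : Order.disp_t} {P : porderType dP}.
Implicit Types (p q : P) (A B : set P).

Definition compatible p q : Prop := exists2 r : P, r <= p & r <= q.

(* Antichain in the sense of forcing: the elements are pairwise incompatible,
   not merely incomparable. *)
Definition antichain A : Prop :=
  forall p q, A p -> A q -> p <> q -> ~ compatible p q.

Definition maximal_antichain A : Prop :=
  antichain A /\ forall B, antichain B -> A `<=` B -> B = A.

Definition refines B A : Prop := forall b, B b -> exists2 a : P, A a & b <= a.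

Definition common_refinement (I : Type) (A : I -> set P) B : Prop :=
  maximal_antichain B /\ forall i : I, refines B (A i).

Definition is_dense A : Prop := forall p, exists2 a : P, A a & a <= p.

End Forcing.

Definition distributive (dP : Order.disp_t) (P : porderType dP) (I : Type) :
    Prop :=
  forall A : I -> set P, (forall i, maximal_antichain (A i)) ->
    exists B : set P, common_refinement A B.

(* [is_distributivity P H] says that h(P) is the cardinality of [H]. *)
Definition is_distributivity (dP : Order.disp_t) (P : porderType dP)
    (H : Type) : Prop :=
  ~ distributive P H /\
  forall K : Type, ~ distributive P K -> [set: H] #<= [set: K].

Section Matrix.
Context {dP dL : Order.disp_t} {P : porderType dP} {L : orderType dL}.
Implicit Types (M : L -> set P) (D : set L) (a : L -> P).

Definition distributivity_matrix M : Prop :=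
  [/\ forall xi : L, maximal_antichain (M xi),
      forall xi eta : L, xi <= eta -> refines (M eta) (M xi) &
      ~ exists B : set P, common_refinement M B].

Definition base_matrix M : Prop :=
  distributivity_matrix M /\ is_dense (\bigcup_xi M xi).

Definition initial_segment D : Prop :=
  forall xi eta : L, D eta -> xi <= eta -> D xi.

(* The length delta of a branch, an ordinal at most the height, is represented
   by the initial segment D of the ordinals below delta; delta is the height
   itself exactly when D is the whole of L.  The values of [a] outside D are
   irrelevant. *)
Definition is_branch M D a : Prop :=
  [/\ initial_segment D,
      forall xi : L, D xi -> M xi (a xi) &
      forall xi eta : L, D eta -> xi <= eta -> a eta <= a xi].

Definition strictly_extends D' a' D a : Prop :=
  D `<` D' /\ forall xi : L, D xi -> a' xi = a xi.

Definition maximal_branch M D a : Prop :=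
  is_branch M D a /\
  ~ exists D' a', is_branch M D' a' /\ strictly_extends D' a' D a.

Definition cofinal_branch M D a : Prop := is_branch M D a /\ D = [set: L].

End Matrix.

(* Main.v *)
Require Import Defs.
From mathcomp Require Import all_boot all_order.
From mathcomp Require Import boolp classical_sets functions cardinality.

(** If every non-cofinal branch can be extended, then any family of at most [h]
    many pairwise comparable elements of the base matrix has a lower bound in
    the matrix: its levels are bounded in [lambda] by regularity, so it
    generates a non-cofinal branch, and any proper extension of that branch
    passes below the whole family.  Now take [h] many maximal antichains with
    no common refinement and a condition [p] below which no element refines
    all of them.  By Zorn's lemma there is a maximal partial choice of
    comparable matrix elements below [p], the [i]-th one lying below an element
    of the [i]-th antichain.  Lower bounds and density of the matrix make this
    choice total, and a lower bound of it contradicts the choice of [p]. *)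

Set Implicit Arguments.
Unset Strict Implicit.
Unset Printing Implicit Defensive.

Import Order.TTheory.
Local Open Scope classical_set_scope.
Local Open Scope order_scope.

Section Antichains.
Context {dP : Order.disp_t} {P : porderType dP}.
Implicit Types (p q : P) (A : set P).

Lemma compatible_sym p q : compatible p q -> compatible q p.
Proof. by move=> [r rp rq]; exists r. Qed.

Lemma antichain_eq A p q : antichain A -> A p -> A q -> compatible p q -> p = q.
Proof. by move=> Aanti Ap Aq pq; apply: contrapT => /(Aanti _ _ Ap Aq); exact. Qed.

Lemma antichain_setU1 A p : antichain A ->
  (forall a, A a -> ~ compatible p a) -> antichain (A `|` [set p]).
Proof.
move=> Aanti pA x y [Ax|->] [Ay|->] //.
- exact: Aanti.
- by move=> _ /compatible_sym; exact: pA.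
- by move=> _; exact: pA.
Qed.

Lemma maximal_antichain_compatible A p :
  maximal_antichain A -> exists2 a, A a & compatible p a.
Proof.
move=> [Aanti Amax]; apply: contrapT => nA.
have pA a : A a -> ~ compatible p a by move=> Aa pa; apply: nA; exists a.
have Ap : A p.
  by rewrite -(Amax _ (antichain_setU1 Aanti pA) (@subsetUl _ _ _)); right.
by apply: (pA _ Ap); exists p.
Qed.

(** Zorn gives an antichain [A] maximal among those inside [E]. If [x] lies in a larger antichain,
    some [r] of [E] below [x] is compatible with some [c] in [A], so [x = c]. *)
Lemma dense_maximal_antichain (E : set P) : is_dense E ->
  exists2 A, maximal_antichain A & A `<=` E.
Proof.
move=> Edense.
have [F Fch FE|A [[Aanti AE] Amax]] :=
  @Zorn_bigcup _ [set A | antichain A /\ A `<=` E].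
  split=> [p q [X FX Xp] [Y FY Yq]|p [X FX Xp]]; last exact: (Fch _ FX).2.
  have [XY|YX] := FE _ _ FX FY.
  - exact: (Fch _ FY).1 (XY _ Xp) Yq.
  - exact: (Fch _ FX).1 Xp (YX _ Yq).
exists A => //; split=> // B Banti AB; apply/seteqP; split=> // x Bx.
have [r Er rx] := Edense x.
have [c Ac [s sr sc]] : exists2 c, A c & compatible r c.
  apply: contrapT => nA.
  have rA a : A a -> ~ compatible r a by move=> Aa ra; apply: nA; exists a.
  apply: (Amax (A `|` [set r])); last first.
    by split; [exact: antichain_setU1 | move=> y [/AE|->]].
  split=> [|Ur]; first exact: subsetUl.
  by apply: (rA r (Ur r (or_intror erefl))); exists r.
suff -> : x = c by [].
by apply: (antichain_eq Banti Bx (AB _ Ac)); exists s => //; exact: le_trans rx.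
Qed.

(** Otherwise the conditions below an element of every [A i] would be dense, and a maximal antichain
    of such conditions would be a common refinement. *)
Lemma not_distributive_condition (I : Type) : ~ distributive P I ->
  exists (A : I -> set P) (p : P), (forall i, maximal_antichain (A i)) /\
    forall r, r <= p -> ~ forall i, exists2 a, A i a & r <= a.
Proof.
move=> nd; apply: contrapT => nA; apply: nd => A Amax.
have Edense : is_dense [set r | forall i, exists2 a, A i a & r <= a].
  move=> p; apply: contrapT => np; apply: nA; exists A, p; split=> // r rp rA.
  by apply: np; exists r.
have [B Bmax BE] := dense_maximal_antichain Edense.
by exists B; split=> // i b /BE.
Qed.

End Antichains.

Section Levels.
Context {dL : Order.disp_t} {L : orderType dL}.

(** An unbounded range would have the size of [L] by regularity, although it is an image of the
    smaller [I]. *)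
Lemma regular_bounded (I : Type) (f : I -> L) : is_regular_cardinal L ->
  card_lt [set: I] [set: L] -> exists x, forall i, f i < x.
Proof.
move=> [_ _ Lreg] [_ LI]; apply: contrapT => nb; apply: LI.
have fub : unbounded (range f).
  move=> x; apply: contrapT => nx; apply: nb; exists x => i.
  by rewrite ltNge; apply/negP => xf; apply: nx; exists (f i).
apply: card_le_trans (card_image_le f setT).
by have := Lreg _ fub; rewrite card_eqPle => -[].
Qed.

End Levels.

Section Bases.
Context {dP dL : Order.disp_t} {P : porderType dP} {L : orderType dL}.
Variable M : L -> set P.
Hypothesis Manti : forall xi, maximal_antichain (M xi).
Hypothesis Mref : forall xi eta, xi <= eta -> refines (M eta) (M xi).
Hypothesis Mext : forall D a, is_branch M D a -> D <> setT ->
  exists D' a', is_branch M D' a' /\ strictly_extends D' a' D a.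

Lemma chain_lower_bound (I : Type) (i0 : I) (f : I -> P) (lev : I -> L) (x : L) :
  (forall i, M (lev i) (f i)) -> (forall i, lev i < x) ->
  (forall i j, f i <= f j \/ f j <= f i) ->
  exists2 q, (\bigcup_xi M xi) q & forall i, f i >= q.
Proof.
move=> Mf levx fch.
pose D := [set xi | exists i, xi <= lev i].
(* The branch takes at level [xi] the element of [M xi] above some member of the family;
   comparability of the members makes it unique. *)
pose above xi q := M xi q /\ exists i, f i <= q.
have above_eq xi q r : above xi q -> above xi r -> q = r.
  move=> [Mq [i fq]] [Mr [j fr]]; apply: (antichain_eq (Manti xi).1 Mq Mr).
  have [fij|fji] := fch i j.
  - by exists (f i) => //; exact: le_trans fr.
  - by exists (f j) => //; exact: le_trans fq.
have [a aP] : {a : L -> P & forall xi, D xi -> above xi (a xi)}.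
  apply: (@choice _ _ (fun xi q => D xi -> above xi q)) => xi.
  (* Outside [D] the value is arbitrary. *)
  have [[i xii]|nD] := pselect (D xi); last by exists (f i0).
  by have [q Mq fq] := Mref xii (Mf i); exists q => _; split=> //; exists i.
have Da : is_branch M D a.
  split=> [xi eta [i etai] xieta|xi /aP[]//|xi eta Deta xieta].
    by exists i; exact: le_trans etai.
  have [Meta [i fi]] := aP _ Deta; have [q Mq aq] := Mref xieta Meta.
  rewrite (above_eq xi (a xi) q) //; last first.
    by split=> //; exists i; exact: le_trans aq.
  by apply: aP; case: Deta => j etaj; exists j; exact: le_trans etaj.
have DT : D <> setT.
  by move=> DT; have [i] : D x by [rewrite DT]; rewrite leNgt levx.
have [D' [a' [[_ Ma' a'le] [[_ D'D] a'a]]]] := Mext Da DT.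
(* A level outside [D] exceeds every [lev i], so the extended branch at [eta] lies below the whole
   family. *)
have [eta D'eta nDeta] : exists2 eta, D' eta & ~ D eta.
  by apply: contrapT => nD; apply: D'D => xi D'xi; apply: contrapT => nDxi;
    apply: nD; exists xi.
exists (a' eta) => [|i]; first by exists eta => //; exact: Ma'.
have Dlev : D (lev i) by exists i.
have -> : f i = a' (lev i).
  by rewrite a'a //; apply: above_eq (aP _ Dlev); split=> //; exists i.
by apply: a'le => //; rewrite leNgt; apply/negP => /ltW etai; apply: nDeta; exists i.
Qed.

End Bases.

Theorem theorem2p3 (dP dL : Order.disp_t) (P : porderType dP)
    (lambda : orderType dL) (h : Type) (M : lambda -> set P)
    (hP : is_distributivity P h)
    (lambda_regular : is_regular_cardinal lambda)
    (h_lt_lambda : card_lt [set: h]%classic [set: lambda]%classic)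
    (M_base : base_matrix M) :
  exists (D : set lambda) (a : lambda -> P),
    maximal_branch M D a /\ ~ cofinal_branch M D a.
Proof.
apply: contrapT => nbranch.
have [[Manti Mref _] Mdense] := M_base.
have Mext D a : is_branch M D a -> D <> setT ->
    exists D' a', is_branch M D' a' /\ strictly_extends D' a' D a.
  move=> Da DT; apply: contrapT => next; apply: nbranch; exists D, a.
  by split=> // -[].
have [A [p [Amax Ap]]] := not_distributive_condition hP.1.
(* Over an empty index type [p] itself would vacuously refine everything. *)
have [i0] : inhabited h.
  by apply: contrapT => nh; apply: (Ap p) => // i; case: nh; exists.
(* All choices are made below the matrix element [c0], which can then stand in for missing
   values. *)
have [c0 Mc0 c0p] := Mdense p.
(* Partial choices are represented by their graphs; [coherent] makes a graph single-valued and its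
   values a chain. *)
pose good (x : h * P) := [/\ (\bigcup_xi M xi) x.2, x.2 <= c0 &
  exists2 b, A x.1 b & x.2 <= b].
pose coherent (x y : h * P) :=
  (x.1 = y.1 -> x.2 = y.2) /\ (x.2 <= y.2 \/ y.2 <= x.2).
have [F Fch FE|G [[Ggood Gcoh] Gmax]] := @Zorn_bigcup _
    [set G | (forall x, G x -> good x) /\ forall x y, G x -> G y -> coherent x y].
  split=> [x [X FX Xx]|x y [X FX Xx] [Y FY Yy]]; first exact: (Fch _ FX).1.
  have [XY|YX] := FE _ _ FX FY.
  - exact: (Fch _ FY).2 (XY _ Xx) Yy.
  - exact: (Fch _ FX).2 Xx (YX _ Yy).
(* Filling the gaps of [G] with [c0] keeps the values comparable, since [c0] is above all of
   them. *)
have [f fP] : {f : h -> P & forall i, G (i, f i) \/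
    ~ (exists q, G (i, q)) /\ f i = c0}.
  apply: (@choice _ _ (fun i q => G (i, q) \/ ~ (exists q, G (i, q)) /\ q = c0)) => i.
  have [[q Gq]|nq] := pselect (exists q, G (i, q)); first by exists q; left.
  by exists c0; right.
have fc0 i : f i <= c0 by have [/Ggood[]|[_ ->]] := fP i.
have [lev Mlev] : {lev : h -> lambda & forall i, M (lev i) (f i)}.
  apply: (@choice _ _ (fun i xi => M xi (f i))) => i.
  have [xi _ Mxi] : (\bigcup_xi M xi) (f i) by have [/Ggood[]|[_ ->]] := fP i.
  by exists xi.
have [x levx] := regular_bounded lev lambda_regular h_lt_lambda.
have fch i j : f i <= f j \/ f j <= f i.
  have [Gi|[_ ->]] := fP i; last by right.
  have [Gj|[_ ->]] := fP j; last by left.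
  exact: (Gcoh _ _ Gi Gj).2.
have [q Mq qf] := chain_lower_bound Manti Mref Mext i0 Mlev levx fch.
have qc0 : q <= c0 := le_trans (qf i0) (fc0 i0).
have qG y : G y -> q <= y.2.
  case: y => i y Gy; have [Gi|[nG _]] := fP i; last by case: nG; exists y.
  by have /= <- := (Gcoh _ _ Gi Gy).1 erefl.
(* If [i] were missing, density would give a matrix element [s] below both [q] and an element of
   [A i]; as [q] bounds all values of [G], the pair [(i, s)] could be added. *)
have Gdom i : exists y, G (i, y).
  apply: contrapT => nGi.
  have [b Ab [r rq rb]] := maximal_antichain_compatible q (Amax i).
  have [s Ms sr] := Mdense r.
  have sG y : G y -> s <= y.2.
    by move=> /qG; apply: le_trans; exact: le_trans rq.
  have nGi1 y : G y -> y.1 <> i.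
    by case: y => j y Gy /= ji; apply: nGi; exists y; rewrite -ji.
  apply: (Gmax (G `|` [set (i, s)])).
    split=> [|sub]; first exact: subsetUl.
    by apply: nGi; exists s; apply: sub; right.
  split=> [y [/Ggood//|->]|y z [Gy|->] [Gz|->]].
  - split=> //=; first exact: le_trans sr (le_trans rq qc0).
    by exists b => //; exact: le_trans rb.
  - exact: Gcoh.
  - by split=> [/nGi1|]; [case | right; exact: sG].
  - by split=> [/esym/nGi1|]; [case | left; exact: sG].
  - by split=> //; left.
apply: (Ap q) => [|i]; first exact: le_trans c0p.
have [y Gy] := Gdom i; have [_ _ [b Ab yb]] := Ggood _ Gy.
by exists b => //; exact: le_trans (qG _ Gy) yb.
Qed.
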